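(* Let $\gamma\colon A\otimes B\to C$ be a $1$-generic linear map of finite-dimensional complex vector spaces with $a=\dim A \ge b=\dim B$, and let $X = X_{b-1}\subset\mathbb{P}(C)$ be the associated determinantal variety. Then for every last syzygy $s\in E_{a-b,b}$ of $X$ the syzygy scheme satisfies $\operatorname{supp}\operatorname{Syz}(s)=\operatorname{supp}X$.
   Context: Conventions: points of $\mathbb{P}(C)$ are one-dimensional quotients of $C$, so elements of $C$ are linear forms on $\mathbb{P}(C)$. $\gamma$ is $1$-generic if for every nonzero $\alpha\in A$ the map $B\to C$, $\beta\mapsto\gamma(\alpha\otimes\beta)$, is injective and for every nonzero $\beta\in B$ the map $A\to C$, $\alpha\mapsto\gamma(\alpha\otimes\beta)$, is injective. Choosing bases, $\gamma$ is an $a\times b$ matrix $M$ of linear forms on $\mathbb{P}(C)$; $X=X_{b-1}$ is the subscheme defined by the ideal $I_X$ generated by the $b\times b$ minors of $M$, i.e. the image of the map $\Lambda^bA\otimes\Lambda^bB\to S_bC$, $(a_1\wedge\dots\wedge a_b)\otimes(b_1\wedge\dots\wedge b_b)\mapsto\det(\gamma(a_i\otimes b_j))$; for $1$-generic $\gamma$ this identifies $(I_X)_b=\Lambda^bA\otimes\Lambda^bB$ and $X$ has expected codimension $a-b+1$, with $I_X$ resolved by the Eagon–Northcott complex whose last syzygy space is $E_{a-b,b}=\Lambda^aA\otimes\Lambda^bB\otimes S_{a-b}B$; its elements are called last syzygies of $X$. Let $e_n\colon\Lambda^nA\otimes S_nB\to\Lambda^n(A\otimes B)\to\Lambda^nC$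 be the natural inclusion followed by $\Lambda^n\gamma$ (its image elements are the degree $n$ exterior minors). A last syzygy is viewed as an element of $\Lambda^{a-b}C\otimes(I_X)_b$ via the composition $\Lambda^aA\otimes\Lambda^bB\otimes S_{a-b}B\hookrightarrow\Lambda^bA\otimes\Lambda^bB\otimes\Lambda^{a-b}A\otimes S_{a-b}B\xrightarrow{\mathrm{id}\otimes e_{a-b}}(I_X)_b\otimes\Lambda^{a-b}C$ (first map induced by comultiplication $\Lambda^aA\to\Lambda^bA\otimes\Lambda^{a-b}A$). Writing $s=\sum_\alpha f_\alpha\otimes v_\alpha$ with $(v_\alpha)$ a basis of $\Lambda^{a-b}C$ and $f_\alpha\in(I_X)_b$, the syzygy ideal $I(s)$ is generated by the $f_\alpha$ and the syzygy scheme is $\operatorname{Syz}(s)=V(I(s))\subset\mathbb{P}(C)$.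
   Formalization: The last syzygy s is assumed nonzero (for s = 0 the syzygy scheme is all of P(C), which differs from X), and b is assumed to be at least 1. *)

(* Defs.v *)
From mathcomp Require Import all_boot all_fingroup all_algebra.
From mathcomp Require Import complex.
From mathcomp Require Import reals.

Set Implicit Arguments.
Unset Strict Implicit.
Unset Printing Implicit Defensive.

Import GRing.Theory.
Local Open Scope ring_scope.

(* strictly increasing maps 'I_m -> 'I_n (= m-subsets, listed increasingly) *)
Definition incr (m n : nat) (f : {ffun 'I_m -> 'I_n}) : bool :=
  [forall i : 'I_m, forall j : 'I_m, (i < j)%N ==> (f i < f j)%N].

(* gamma : A (x) B -> C is given by g i j = gamma(a_i (x) b_j) in C = K^c *)
Definition gam (K : fieldType) (a b c : nat) (g : 'I_a -> 'I_b -> 'rV[K]_c)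
  (al : 'rV[K]_a) (be : 'rV[K]_b) : 'rV[K]_c :=
  \sum_(i < a) \sum_(j < b) (al 0 i * be 0 j) *: g i j.

Definition one_generic (K : fieldType) (a b c : nat)
  (g : 'I_a -> 'I_b -> 'rV[K]_c) : Prop :=
  (forall al : 'rV[K]_a, al != 0 -> injective (gam g al)) /\
  (forall be : 'rV[K]_b, be != 0 -> injective (fun al => gam g al be)).

(* The matrix M of linear forms, evaluated at the point x of P(C)
   (x = coordinates of a nonzero linear functional on C). *)
Definition Mat (K : fieldType) (a b c : nat) (g : 'I_a -> 'I_b -> 'rV[K]_c)
  (x : 'rV[K]_c) : 'M[K]_(a, b) :=
  \matrix_(i, j) \sum_(k < c) (g i j) 0 k * x 0 k.

Definition minor (K : fieldType) (a b : nat) (sigma : {ffun 'I_b -> 'I_a})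
  (N : 'M[K]_(a, b)) : K :=
  \det (\matrix_(k, j) N (sigma k) j).

Definition inX (K : fieldType) (a b c : nat) (g : 'I_a -> 'I_b -> 'rV[K]_c)
  (x : 'rV[K]_c) : Prop :=
  forall sigma : {ffun 'I_b -> 'I_a}, incr sigma -> minor sigma (Mat g x) = 0.

Definition complementary (a b : nat) (sigma : {ffun 'I_b -> 'I_a})
  (tau : {ffun 'I_(a - b) -> 'I_a}) : bool :=
  [&& incr sigma, incr tau & [forall k, forall l, sigma k != tau l]].

(* sign of the shuffle permutation (S, S^c): e_S /\ e_{S^c} = sign e_1/\../\e_a;
   this is the coefficient of e_S (x) e_{S^c} in the comultiplication *)
Definition shuffle_sign (K : fieldType) (a b : nat) (sigma : {ffun 'I_b -> 'I_a})
  (tau : {ffun 'I_(a - b) -> 'I_a}) : K :=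
  (-1) ^+ #|[set p : 'I_b * 'I_(a - b) | (tau p.2 < sigma p.1)%N]|.

(* S_n B realised as symmetric tensors q : B^(x)n (coordinates q J) *)
Definition symmetric_tensor (K : fieldType) (n b : nat)
  (q : {ffun 'I_n -> 'I_b} -> K) : Prop :=
  forall (s : 'S_n) (J : {ffun 'I_n -> 'I_b}), q [ffun i => J (s i)] = q J.

(* coordinate at e_{T 0} /\ ... /\ e_{T (n-1)} (T increasing) of
   e_n((a_{tau 0} /\ ... /\ a_{tau (n-1)}) (x) q) in Lambda^n C, where
   e_n((a_1/\../\a_n)(x)(b_{J1}(x)..(x)b_{Jn})) = gamma(a_1(x)b_{J1})/\../\gamma(a_n(x)b_{Jn}) *)
Definition e_coord (K : fieldType) (a b c n : nat) (g : 'I_a -> 'I_b -> 'rV[K]_c)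
  (tau : {ffun 'I_n -> 'I_a}) (q : {ffun 'I_n -> 'I_b} -> K)
  (T : {ffun 'I_n -> 'I_c}) : K :=
  \sum_(J : {ffun 'I_n -> 'I_b}) q J * \det (\matrix_(k, l) (g (tau k) (J k)) 0 (T l)).

(* The generator f_T of I(s) (coefficient of the basis vector e_T of
   Lambda^{a-b} C in the image of s = (e_A (x) e_B (x) q)), evaluated at x:
   s |-> sum_S sign(S,S^c) det(M_{S}) (x) e_{a-b}(e_{S^c} (x) q). *)
Definition syz_gen (K : fieldType) (a b c : nat) (g : 'I_a -> 'I_b -> 'rV[K]_c)
  (q : {ffun 'I_(a - b) -> 'I_b} -> K) (T : {ffun 'I_(a - b) -> 'I_c})
  (x : 'rV[K]_c) : K :=
  \sum_(sigma : {ffun 'I_b -> 'I_a} | incr sigma)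
    \sum_(tau : {ffun 'I_(a - b) -> 'I_a} | complementary sigma tau)
      shuffle_sign K sigma tau * minor sigma (Mat g x) * e_coord g tau q T.

Definition inSyz (K : fieldType) (a b c : nat) (g : 'I_a -> 'I_b -> 'rV[K]_c)
  (q : {ffun 'I_(a - b) -> 'I_b} -> K) (x : 'rV[K]_c) : Prop :=
  forall T : {ffun 'I_(a - b) -> 'I_c}, incr T -> syz_gen g q T x = 0.

(* Main.v *)
Require Import Defs.
From HB Require Import structures.
From mathcomp Require Import all_boot all_fingroup all_algebra.
From mathcomp Require Import complex.
From mathcomp Require Import boolp functions reals.
Set Implicit Arguments.
Unset Strict Implicit.
Unset Printing Implicit Defensive.
Import GRing.Theory Num.Theory.
Local Open Scope ring_scope.

(** Suppose x is not in X, so that M(x) has rank b. By symmetry of q and Laplace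
    expansion along the first b columns, the generator of I(s) with index T takes
    at x the value sum_J q_J det [M(x) | (g i (J l) (T l))_(i,l)]. Row operations
    bring M(x) to the form (E; 0) with E invertible, and the value becomes, up to
    a nonzero factor, a coordinate of e_n(q) for n = a - b and the restriction
    of gamma to A' (x) B, where A' is the n-dimensional space of forms killed by
    M(x). It remains to see that e_n is injective when n = dim A'.

    Each alpha in A' acts on Lambda C (x) S B by the Koszul-type differential
    D_alpha = sum_j gamma(alpha (x) b_j) /\ d/db_j. These operators anticommute, e_n
    is the product of the D_alpha over a basis of A', and 1-genericity makes each
    D_alpha with alpha <> 0 exact in positive symmetric degree. A graded module
    over an exterior algebra on which every nonzero degree one element is exact is
    free (the rank variety criterion), hence the top product is injective in the
    lowest degree; this reduces to two generators, where it follows from the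
    existence of eigenvalues over the algebraically closed field. *)

(** * Modules over an exterior algebra *)

Section ExteriorModules.
Variables (K : closedFieldType) (U : lmodType K).

Definition is_submod (G : U -> Prop) : Prop :=
  G 0 /\ forall a u v, G u -> G v -> G (a *: u + v).

(** The dependency is recorded as a polynomial so that linear factors can be split off over the
    algebraically closed field. *)
Definition finite_rank (G : U -> Prop) : Prop :=
  forall v : nat -> U, (forall i, G (v i)) ->
  exists M (f : {poly K}),
    [/\ f != 0, (size f <= M)%N & \sum_(i < M) f`_i *: v i = 0].

Lemma is_submodD G u v : is_submod G -> G u -> G v -> G (u + v).
Proof. by move=> [_ cG] Gu Gv; rewrite -[u]scale1r; apply: cG. Qed.

Lemma is_submodZ G a u : is_submod G -> G u -> G (a *: u).
Proof. by move=> [G0 cG] Gu; rewrite -[_ *: _]addr0; apply: cG. Qed.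

Lemma is_submodN G u : is_submod G -> G u -> G (- u).
Proof. by move=> sG Gu; rewrite -scaleN1r; apply: is_submodZ. Qed.

Lemma is_submod_sum G (I : Type) (r : seq I) (F : I -> U) :
  is_submod G -> (forall i, G (F i)) -> G (\sum_(i <- r) F i).
Proof.
by move=> sG GF; elim/big_ind: _ => // [|u v Gu Gv]; [case: sG | apply: is_submodD].
Qed.

(* The relation [d1 w = d2 v] behaves like an operator [v |-> w] modulo
   [d1 Gm + d2 Gm]; a dependency among the iterates of [v] is a polynomial
   killing [v], and each of its roots [l] is removed by exactness of
   [d2 - l d1]. *)
Lemma pencil_exact (d1 d2 : {linear U -> U}) (S G Gm : U -> Prop) :
    is_submod G -> is_submod Gm -> finite_rank G ->
    (forall u, G u -> S u) -> (forall u, Gm u -> S u) ->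
    (forall u, S u -> d1 (d2 u) = - d2 (d1 u)) ->
    (forall u, S u -> d1 (d1 u) = 0) -> (forall u, S u -> d2 (d2 u) = 0) ->
    (forall u, Gm u -> G (d1 u)) ->
    (forall v, G v -> d1 (d2 v) = 0 -> exists2 w, G w & d1 w = d2 v) ->
    (forall l v, G v -> d2 v = l *: d1 v ->
       exists2 u, Gm u & d2 u - l *: d1 u = v) ->
  forall v, G v -> d1 (d2 v) = 0 ->
  exists s t, [/\ Gm s, Gm t & v = d1 s + d2 t].
Proof.
move=> sG sGm rkG GS GmS anti sq1 sq2 Gmd1 ex1 exl v Gv dv.
(* The relation becomes a total function, with value 0 off its domain, so that it can be iterated on
   [v]. *)
have /choice [f Hf] : forall v, exists w, (G v /\ d1 (d2 v) = 0) ->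
    (G w /\ d1 (d2 w) = 0) /\ d1 w = d2 v.
  move=> {Gv dv} u; case: (pselect (G u /\ d1 (d2 u) = 0)) => [[Gu du]|nu]; last by exists 0.
  have [w Gw dw] := ex1 u Gu du; exists w => _; split => //; split=> //.
  by rewrite anti ?dw ?sq2 ?oppr0 //; exact: GS.
pose vs i := iter i f v.
have Hvs i : G (vs i) /\ d1 (d2 (vs i)) = 0.
  by elim: i => [|i IH] //=; have [] := Hf _ IH.
have dvs i : d1 (vs i.+1) = d2 (vs i) by have [] := Hf _ (Hvs i).
have [|M [g [g0 sg gv]]] := rkG vs; first by move=> i; case: (Hvs i).
pose act (h : {poly K}) := \sum_(i < M) h`_i *: vs i.
pose B u := exists s t, [/\ Gm s, Gm t & u = d1 s + d2 t].
have Bact : B (act g).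
  by exists 0, 0; rewrite !linear0 addr0; split; [case: sGm | case: sGm | ].
(* Descent on the degree of [h]: as long as [act h] lies in [B], a linear factor can be removed, and
   a nonzero constant [h] gives [v] up to a scalar. *)
suff main (k : nat) (h : {poly K}) : h != 0 -> (size h <= M)%N -> (size h <= k.+1)%N -> B (act h) -> B v.
  by apply: (main (size g) g).
elim: k h {g g0 sg gv Bact} => [|k IH] h h0 sM sk Bh.
  have [c c0 hc] : exists2 c, c != 0 & h = c%:P.
    have h1 : size h == 1%N by rewrite eqn_leq sk lt0n size_poly_eq0 h0.
    by move/size_poly1P: h1 => [c c0 ->]; exists c.
  case: M @act sM Bh => [|M] act sM Bh.
    by move: h0; rewrite -size_poly_leq0 sM.
  have acth : act h = c *: v.
    rewrite /act hc big_ord_recl coefC eqxx big1 ?addr0 // => i _.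
    by rewrite coefC /= scale0r.
  case: Bh => s [t [Gs Gt E]]; exists (c^-1 *: s), (c^-1 *: t).
  split; [exact: is_submodZ | exact: is_submodZ | ].
  by rewrite !linearZ /= -scalerDr -E acth scalerA mulVf ?scale1r.
case: (leqP (size h) k.+1) => [|sk']; first by move=> sk'; apply: (IH h).
have : size h != 1%N by rewrite gtn_eqF // (leq_trans _ sk').
move=> /closed_rootP [l /factor_theorem [r hr]].
have r0 : r != 0 by apply: contra_neq h0 => r0; rewrite hr r0 mul0r.
have sr : size h = (size r).+1 by rewrite hr size_Mmonic ?monicXsubC // size_XsubC addn2.
apply: (IH r) => //.
- by apply: leq_trans sM; rewrite sr.
- by rewrite -ltnS -sr.
(* By [dvs], applying [d2] is multiplying by ['X] under [d1]; the truncation at [M] loses nothing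
   because [size r < M]. *)
have shift : d2 (act r) = d1 (act (r * 'X)).
  case: M @act sM Bh IH => [|M] act sM Bh IH.
    by rewrite /act !big_ord0 !linear0.
  rewrite /act !linear_sum big_ord_recr big_ord_recl /= coefMX eqxx scale0r linear0 add0r.
  have -> : r`_M = 0 by apply: nth_default; rewrite -ltnS -sr.
  rewrite scale0r linear0 addr0.
  apply: eq_bigr => i _; rewrite !linearZ /= coefMX /=.
  by rewrite -dvs.
have actX : act (r * 'X) = act h + l *: act r.
  rewrite /act scaler_sumr -big_split /=; apply: eq_bigr => i _.
  by rewrite hr mulrBr coefB coefMC scalerA -scalerDl [l * _]mulrC subrK.
have Gr : G (act r).
  by apply: is_submod_sum => // i; apply: is_submodZ => //; case: (Hvs i).
case: Bh => s [t [Gs Gt E]].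
(* With [act h = d1 s + d2 t], the element [act r + d1 t] is killed by [d2 - l d1], hence lies in
   the image of that operator. *)
have [||u Gu Eu] := exl l (act r + d1 t).
- by apply: is_submodD => //; apply: Gmd1.
- have d1E : d1 (act h) = - d2 (d1 t).
    by rewrite E linearD sq1 ?add0r ?anti //; exact: GmS.
  rewrite !linearD (sq1 t) ?addr0; last exact: GmS.
  by rewrite shift actX linearD d1E linearZ /= addrAC addNr add0r linear0 addr0.
exists (- (l *: u) - t), u; split=> //.
  by apply: is_submodD => //; apply: is_submodN => //; apply: is_submodZ.
by rewrite linearB linearN /= linearZ /= addrAC [- _ + _]addrC Eu addrK.
Qed.

Definition lcomb (k : nat) (lam : nat -> K) (D : nat -> {linear U -> U}) (u : U) :=
  \sum_(i < k) lam i *: D i u.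

Lemma lcomb_linear k lam D : linear (lcomb k lam D).
Proof.
move=> a u v; rewrite /lcomb scaler_sumr -big_split /=; apply: eq_bigr => i _.
by rewrite linearP scalerDr !scalerA mulrC.
Qed.

HB.instance Definition _ k lam D :=
  GRing.isLinear.Build K U U *:%R (lcomb k lam D) (lcomb_linear k lam D).

(* Degrees are shifted by one, so that [G 0] is the zero space. The induction
   replaces [G] by the image of the last operator. *)
Lemma top_product_injective (S : U -> Prop) k N (G : nat -> U -> Prop)
    (D : nat -> {linear U -> U}) :
    (forall p, is_submod (G p)) -> (forall p, finite_rank (G p)) ->
    (forall u, G 0 u -> u = 0) -> (forall p u, G p u -> S u) ->
    (forall i j u, S u -> D i (D j u) = - D j (D i u)) ->
    (forall i u, S u -> D i (D i u) = 0) ->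
    (forall p i u, (i < k)%N -> G p u -> G p.+1 (D i u)) ->
    (forall lam p v, (exists2 i, (i < k)%N & lam i != 0) -> (p < N)%N ->
       G p.+1 v -> lcomb k lam D v = 0 -> exists2 u, G p u & lcomb k lam D u = v) ->
    (k <= N)%N ->
  forall v, G 1 v -> foldr (fun i w => D i w) v (iota 0 k) = 0 -> v = 0.
Proof.
elim: k N G => [|k IH] N G sG rkG G0 GS anti sq DG ex leN v Gv //.
(* Passing to the image of [D k] uses up one degree of the range of exactness, so [N] drops along
   with [k]. *)
case: N leN ex => // N leN ex.
rewrite -addn1 iotaD foldr_cat /= add0n => top.
have extend lam c : exists lam', (lam' k = c) /\
    (forall u, lcomb k.+1 lam' D u = lcomb k lam D u + c *: D k u) /\
    (forall i, (i < k)%N -> lam' i = lam i).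
  exists (fun i => if i == k then c else lam i); rewrite eqxx; split=> //; split.
    move=> u; rewrite /lcomb big_ord_recr /= eqxx; congr (_ + _).
    by apply: eq_bigr => i _; rewrite ltn_eqF.
  by move=> i ik; rewrite ltn_eqF.
pose G' p u := exists2 v, G p v & u = D k v.
(* Exactness of [D k] in the lowest degree, where [G 0] is zero, makes it injective on [G 1]. *)
suff Dv : D k v = 0.
  have [lam [lamk [lamE _]]] := extend (fun=> 0) 1.
  have l0 u : lcomb k (fun=> 0) D u = 0 by rewrite /lcomb big1 // => i _; rewrite scale0r.
  have [||u /G0 -> <-] := ex lam 0 v _ isT Gv.
  - by exists k; rewrite ?lamk ?oner_eq0.
  - by rewrite lamE l0 Dv scaler0 addr0.
  - by rewrite linear0.
apply: (IH N G') => //; last by exists v.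
- move=> p; split; first by exists 0; rewrite ?linear0 //; case: (sG p).
  move=> a u w [u' Gu ->] [w' Gw ->]; exists (a *: u' + w'); last by rewrite linearP.
  by case: (sG p) => _; apply.
- move=> p w G'w; apply: (rkG p.+1) => i; have [u Gu ->] := G'w i.
  exact: DG.
- by move=> u [w /G0 -> ->]; rewrite linear0.
- by move=> p u [w Gw ->]; apply: (GS p.+1); apply: DG.
- move=> p i u ik [w Gw ->]; exists (- D i w).
    by apply: is_submodN => //; apply: DG => //; apply: ltnW.
  by rewrite linearN /= anti //; apply: GS Gw.
move=> lam p w [i ik li] pN [u Gu ->] Dw.
have antiL z : S z -> lcomb k lam D (D k z) = - D k (lcomb k lam D z).
  move=> Sz; rewrite /lcomb linear_sum -sumrN; apply: eq_bigr => j _.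
  by rewrite linearZ /= anti // scalerN.
have sqL z : S z -> lcomb k lam D (lcomb k lam D z) = 0.
  move=> Sz; rewrite {1}/lcomb.
  transitivity (\sum_(j < k) \sum_(l < k) (lam j * lam l) *: D j (D l z)).
    apply: eq_bigr => j _; rewrite linear_sum scaler_sumr; apply: eq_bigr => l _.
    by rewrite linearZ /= scalerA.
  have : forall n, \sum_(j < n) \sum_(l < n) (lam j * lam l) *: D j (D l z) = 0.
    elim=> [|n IHn]; first by rewrite big_ord0.
    rewrite big_ord_recr /= [X in _ + X]big_ord_recr /= sq // scaler0 addr0.
    rewrite (eq_bigr _ (fun j _ => big_ord_recr _ _)) /= big_split /= IHn add0r.
    rewrite -big_split big1 // => j _ /=.
    by rewrite anti // mulrC scalerN addNr.
  by apply.
have DGL z : G p z -> G p.+1 (lcomb k lam D z).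
  move=> Gz; apply: is_submod_sum => // j; apply: is_submodZ => //.
  by apply: DG => //; apply/ltnW/ltn_ord.
have ex1 z : G p.+1 z -> lcomb k lam D (D k z) = 0 ->
    exists2 y, G p.+1 y & lcomb k lam D y = D k z.
  move=> Gz Dz; have [lam' [lk [lE lS]]] := extend lam 0.
  have [||||y Gy Ey] := ex lam' p.+1 (D k z).
  + by exists i; rewrite ?lS // ltnW.
  + by [].
  + exact: DG.
  + by rewrite lE Dz scale0r addr0.
  by exists y => //; rewrite -Ey lE scale0r addr0.
have exl l z : G p.+1 z -> D k z = l *: lcomb k lam D z ->
    exists2 y, G p y & D k y - l *: lcomb k lam D y = z.
  move=> Gz Dz; have [lam' [lk [lE lS]]] := extend (fun i => - l * lam i) 1.
  have lE' y : lcomb k.+1 lam' D y = D k y - l *: lcomb k lam D y.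
    rewrite lE scale1r addrC; congr (_ + _).
    rewrite /lcomb scaler_sumr -sumrN; apply: eq_bigr => j _.
    by rewrite scalerA mulNr scaleNr.
  have [||||y Gy Ey] := ex lam' p z.
  + by exists k; rewrite ?lk ?oner_eq0.
  + exact: ltnW.
  + by [].
  + by rewrite lE' Dz subrr.
  by exists y => //; rewrite -Ey lE'.
(* Writing L for [lcomb k lam D], this gives [u = L s + D k t], whence [D k u = L (- D k s)], an
   image of an element of [G' p]. *)
have [s [t [Gs Gt ->]]] := pencil_exact (sG _) (sG _) (rkG _) (GS _) (GS _)
  antiL sqL (sq k) DGL ex1 exl Gu Dw.
exists (- D k s).
  by exists (- s); rewrite ?linearN //; apply: is_submodN.
by rewrite linearD /= sq ?addr0 ?linearN /= ?antiL ?opprK //; apply: GS; eauto.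
Qed.

End ExteriorModules.

(** * Laplace expansion along a set of columns *)

Section Increasing.
Variables m n : nat.
Implicit Types f h : {ffun 'I_m -> 'I_n}.

Lemma incrP f : reflect (forall i j : 'I_m, (i < j)%N -> (f i < f j)%N) (incr f).
Proof.
apply: (iffP forallP) => [H i j|H i]; first by move/forallP: (H i) => /(_ j)/implyP.
by apply/forallP => j; apply/implyP; apply: H.
Qed.

Lemma incr_inj f : incr f -> injective f.
Proof.
move=> /incrP If i j /(congr1 val) /= E; apply: val_inj => /=.
by case: (ltngtP i j) => // /If; rewrite E ltnn.
Qed.

Lemma incr_sorted f : incr f -> sorted ltn (map val (codom f)).
Proof.
move=> /incrP If; rewrite /codom /image_mem -map_comp.
apply: (@homo_sorted _ _ (val \o f) (fun i j : 'I_m => (i < j)%N)) => //.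
have := iota_ltn_sorted 0 m; rewrite -val_enum_ord sorted_map.
by rewrite enumT.
Qed.

Lemma incr_codom_inj f h : incr f -> incr h -> codom f =i codom h -> f = h.
Proof.
move=> If Ih E.
have Ev : map val (codom f) = map val (codom h).
  apply: (irr_sorted_eq ltn_trans ltnn); [exact: incr_sorted.. |].
  by move=> x; apply/mapP/mapP => -[y Hy ->]; exists y => //; rewrite ?E // -E.
apply/ffunP => i; apply: val_inj => /=.
have nthE (k : {ffun 'I_m -> 'I_n}) : nth (f i) (codom k) i = k i.
  by rewrite -[codom k]/(tval (mktuple k)) -tnth_nth tnth_mktuple.
have := congr1 (fun s => nth (val (f i)) s i) Ev.
by rewrite /= !(nth_map (f i)) ?size_codom ?card_ord // !nthE.
Qed.

Lemma exists_sorting_perm f : injective f ->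
  exists p : 'S_m, incr [ffun i => f (p i)].
Proof.
move=> If; pose r (x y : 'I_n) := (x <= y)%N.
(* Sorting the list of values yields the permutation; injectivity makes the weak order strict. *)
have : perm_eq (sort r (codom f)) (mktuple f).
  by rewrite perm_sort.
case/tuple_permP => p Ep; exists p; apply/incrP => i j ij; rewrite !ffunE.
have Hn (k : 'I_m) : nth (f i) (sort r (codom f)) k = f (p k).
  by rewrite Ep -tnth_nth !tnth_mktuple.
have rtr : transitive r by move=> x y z; apply: leq_trans.
have rtot : total r by move=> x y; apply: leq_total.
have := sort_sorted rtot (codom f).
move=> /(sorted_ltn_nth rtr) => /(_ (f i) i j).
rewrite !inE size_sort size_codom card_ord !ltn_ord !Hn => /(_ isT isT ij).
rewrite /r leq_eqVlt => /orP[/eqP E|//].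
by move: ij; rewrite (perm_inj (If _ _ (val_inj E))) ltnn.
Qed.
End Increasing.

(* Read off from the Vandermonde determinant of 0, ..., n - 1. *)
Lemma perm_sign_pairs n (s : 'S_n) :
  (-1) ^+ s = \prod_(i < n) \prod_(j < n | (i < j)%N) (if (s j < s i)%N then -1 else 1) :> int.
Proof.
pose v (f : 'I_n -> 'I_n) : 'rV[int]_n := \row_i (f i)%:Z.
have E f : \det (Vandermonde n (v f)) =
    \prod_(i < n) \prod_(j < n | (i < j)%N) ((f j)%:Z - (f i)%:Z).
  rewrite det_Vandermonde; apply: eq_bigr => i _; apply: eq_bigr => j _.
  by rewrite !mxE.
have Vs : Vandermonde n (v s) = col_perm s (Vandermonde n (v id)).
  by apply/matrixP => i j; rewrite !mxE.
have pos : 0 < \det (Vandermonde n (v id)).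
  by rewrite E; apply: prodr_gt0 => i _; apply: prodr_gt0 => j ij; rewrite subr_gt0 ltz_nat.
have := E s; rewrite Vs col_permE det_mulmx det_perm.
move=> /(congr1 Num.sg); rewrite sgrM (gtr0_sg pos) mul1r odd_permV.
have -> : Num.sg ((-1) ^+ s) = (-1) ^+ s :> int by case: odd_perm.
move=> ->; rewrite (big_morph _ (@sgrM _) (@sgr1 _)); apply: eq_bigr => i _.
rewrite (big_morph _ (@sgrM _) (@sgr1 _)); apply: eq_bigr => j ij.
case: ltnP => [lt|le]; first by rewrite ltr0_sg // subr_lt0 ltz_nat.
rewrite gtr0_sg // subr_gt0 ltz_nat ltn_neqAle le andbT.
by apply: contraTneq ij => /val_inj/perm_inj ->; rewrite ltnn.
Qed.

Section Laplace.
Variables (K : fieldType) (b n : nat).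

Definition complements (sigma : {ffun 'I_b -> 'I_(b + n)})
    (tau : {ffun 'I_n -> 'I_(b + n)}) :=
  [&& incr sigma, incr tau & [forall k, forall l, sigma k != tau l]].

Definition glue (sigma : {ffun 'I_b -> 'I_(b + n)})
    (tau : {ffun 'I_n -> 'I_(b + n)}) (j : 'I_(b + n)) :=
  match fintype.split j with inl k => sigma k | inr l => tau l end.

Lemma glue_lshift sigma tau k : glue sigma tau (lshift n k) = sigma k.
Proof. by rewrite /glue -/(unsplit (inl k)) unsplitK. Qed.

Lemma glue_rshift sigma tau l : glue sigma tau (rshift b l) = tau l.
Proof. by rewrite /glue -/(unsplit (inr l)) unsplitK. Qed.

Lemma glue_inj sigma tau : complements sigma tau -> injective (glue sigma tau).
Proof.
case/and3P => Is It /forallP dis i j.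
have D k l : sigma k != tau l by have /forallP := dis k; apply.
case: (split_ordP i) => i' ->; case: (split_ordP j) => j' ->;
  rewrite ?glue_lshift ?glue_rshift => E.
- by rewrite (incr_inj Is E).
- by move: (D i' j'); rewrite E eqxx.
- by move: (D j' i'); rewrite E eqxx.
- by rewrite (incr_inj It E).
Qed.

(** The shuffle is increasing on each block, so its inversions are exactly the inverted pairs across
    the two blocks. *)
Lemma sign_glue sigma tau (w : 'S_(b + n)) :
    complements sigma tau -> w =1 glue sigma tau ->
  (-1) ^+ w = (-1) ^+ #|[set p : 'I_b * 'I_n | (tau p.2 < sigma p.1)%N]| :> int.
Proof.
case/and3P => /incrP Is /incrP It _ wE.
rewrite perm_sign_pairs big_split_ord /=.
rewrite [X in _ * X]big1 ?mulr1; last first.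
  move=> i _; rewrite big1 // => j; case: (split_ordP j) => j' ->.
    by move=> /=; rewrite ltnNge ltnW // (leq_trans (ltn_ord j')) ?leq_addr.
  by rewrite !wE !glue_rshift /= ltn_add2l => /It; rewrite ltnNge leq_eqVlt orbC => /negbTE; case: ltnP.
transitivity (\prod_(k < b) \prod_(l < n) (if (tau l < sigma k)%N then -1 else 1 : int)).
  apply: eq_bigr => k _; rewrite big_split_ord /= [X in X * _]big1 ?mul1r.
    apply: eq_big => [l|l _]; first by rewrite ltn_addr // ltn_ord.
    by rewrite !wE glue_lshift glue_rshift.
  by move=> l kl; rewrite !wE !glue_lshift ltnNge ltnW ?Is.
rewrite pair_bigA /= -big_mkcond prodr_const.
by congr (_ ^+ _); apply: eq_card => p; rewrite !inE.
Qed.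

(** The point [x0] lists in increasing order the images under [s] of the first [b] indices, then of
    the others. The form as an equality with [x0] lets a sum over pairs collapse to one term. *)
Lemma complements_perm_unique (s : 'S_(b + n)) : exists x0, forall x,
  complements x.1 x.2 && [forall j, (s j \in codom x.1) == (j < b)%N] = (x == x0).
Proof.
have inl_ : injective [ffun k => s (lshift n k)].
  by move=> i j; rewrite !ffunE => /perm_inj/lshift_inj.
have inr_ : injective [ffun l => s (rshift b l)].
  by move=> i j; rewrite !ffunE => /perm_inj/rshift_inj.
have [p Ip] := exists_sorting_perm inl_; have [r Ir] := exists_sorting_perm inr_.
set sg := finfun _ in Ip; set ta := finfun _ in Ir.
have sgE j : (s j \in codom sg) = (j < b)%N.
  apply/codomP/idP => [[k]|jb].
    by rewrite !ffunE => /perm_inj ->; rewrite /= ltn_ord.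
  exists ((p^-1)%g (Ordinal jb)); rewrite !ffunE permKV.
  by congr (s _); apply: val_inj.
have taE j : (s j \in codom ta) = (b <= j)%N.
  apply/codomP/idP => [[k]|jb].
    by rewrite !ffunE => /perm_inj ->; rewrite /= leq_addr.
  have jn : (j - b < n)%N by rewrite ltn_subLR.
  exists ((r^-1)%g (Ordinal jn)); rewrite !ffunE permKV.
  by congr (s _); apply: val_inj; rewrite /= subnKC.
exists (sg, ta) => -[sigma tau] /=; apply/andP/eqP => [[C /forallP H]|[-> ->]]; last first.
  split; last by apply/forallP => j; rewrite sgE.
  apply/and3P; split=> //; apply/forallP => k; apply/forallP => l.
  by rewrite !ffunE (inj_eq perm_inj) eq_lrshift.
have {}H j : (s j \in codom sigma) = (j < b)%N by apply/eqP/H.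
have T j : (s j \in codom tau) = (b <= j)%N.
  have [w wE] : exists w : 'S_(b + n), w =1 glue sigma tau.
    by exists (perm (glue_inj C)) => j'; rewrite permE.
  case/and3P: C => Is It /forallP dis.
  have D k l : sigma k != tau l by have /forallP := dis k; apply.
  rewrite leqNgt -H; apply/codomP/idP => [[l ->]|].
    by apply/codomP => -[k /esym/eqP]; apply/negP.
  rewrite -[s j](permKV w) wE; case: (split_ordP ((w^-1)%g (s j))) => k ->.
    by rewrite glue_lshift codom_f.
  by rewrite glue_rshift; exists k.
case/and3P: C => Is It _; congr (_, _); apply: incr_codom_inj => // i.
  by rewrite -[ i ](permKV s) H sgE.
by rewrite -[ i ](permKV s) T taE.
Qed.

(* [Z sigma] keeps the first [b] columns on the rows in the image of [sigma] and
   the last [n] columns on the other rows; a permutation [s] contributes to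
   [\det (Z sigma)] only if [sigma] enumerates the images of the first [b]
   indices under [s], which determines the pair (sigma, tau). *)
Lemma laplace_expansion (X : 'M[K]_(b + n, b)) (Y : 'M[K]_(b + n, n)) :
  \sum_(sigma | incr sigma) \sum_(tau | complements sigma tau)
    (-1) ^+ #|[set p : 'I_b * 'I_n | (tau p.2 < sigma p.1)%N]|
    * \det (\matrix_(k, j) X (sigma k) j) * \det (\matrix_(l, j) Y (tau l) j)
  = \det (row_mx X Y).
Proof.
pose Z (sigma : {ffun 'I_b -> 'I_(b + n)}) := \matrix_(i, j)
  if (i \in codom sigma) == (j < b)%N then row_mx X Y i j else 0.
have detZ sigma tau : complements sigma tau ->
   (-1) ^+ #|[set p : 'I_b * 'I_n | (tau p.2 < sigma p.1)%N]|
    * \det (\matrix_(k, j) X (sigma k) j) * \det (\matrix_(l, j) Y (tau l) j)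
   = \det (Z sigma).
  move=> C; have [w wE] : exists w : 'S_(b + n), w =1 glue sigma tau.
    by exists (perm (glue_inj C)) => j'; rewrite permE.
  have sw : (-1) ^+ w = (-1) ^+ #|[set p : 'I_b * 'I_n | (tau p.2 < sigma p.1)%N]| :> K.
    have := sign_glue C wE; move/(congr1 (fun z : int => z%:~R : K)).
    by rewrite !rmorphXn /= !rmorphN1.
  (* Listing the rows in [sigma] first makes [Z sigma] block diagonal. *)
  have : row_perm w (Z sigma) = block_mx (\matrix_(k, j) X (sigma k) j) 0 0
                                         (\matrix_(l, j) Y (tau l) j).
    case/and3P: (C) => _ _ /forallP dis.
    have D l : (tau l \in codom sigma) = false.
      by apply/negbTE/codomP => -[k /esym/eqP]; apply/negP; have /forallP := dis k; apply.
    apply/matrixP => i j; rewrite mxE mxE wE.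
    case: (split_ordP i) => i' ->; case: (split_ordP j) => j' ->;
      rewrite ?glue_lshift ?glue_rshift ?codom_f ?D /= ?ltn_ord ?ltnNge ?leq_addr /=.
    - by rewrite block_mxEul row_mxEl mxE.
    - by rewrite block_mxEur mxE.
    - by rewrite block_mxEdl mxE.
    - by rewrite block_mxEdr row_mxEr mxE.
  rewrite row_permE => /(congr1 (fun M => (-1) ^+ w * \det M)).
  by rewrite det_mulmx det_perm mulrA -expr2 sqrr_sign mul1r => ->; rewrite det_ublock sw mulrA.
under eq_bigr => sigma _ do under eq_bigr => tau C do rewrite detZ //.
(* The Leibniz formula is indexed by columns to match the condition on [s j] in
   [complements_perm_unique]. *)
have detE (M : 'M[K]_(b + n)) :
    \det M = \sum_(s : 'S_(b + n)) (-1) ^+ s * \prod_j M (s j) j.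
  by rewrite -det_tr; apply: eq_bigr => s _; congr (_ * _); apply: eq_bigr => j _; rewrite mxE.
rewrite pair_big_dep /=.
under eq_bigr => x _ do rewrite detE.
rewrite exchange_big /= detE; apply: eq_bigr => s _.
have [x0 Hx0] := complements_perm_unique s.
rewrite (bigD1 x0) /=; last first.
  by have := Hx0 x0; rewrite eqxx => /andP[C _]; case/and3P: (C) => ->.
rewrite [X in _ + X]big1 ?addr0.
  congr (_ * _); apply: eq_bigr => j _; rewrite mxE.
  by have := Hx0 x0; rewrite eqxx => /andP[_ /forallP ->].
move=> x /andP[/andP[_ C]]; rewrite -Hx0 C /= => /forallPn[j /negbTE nj].
by rewrite (bigD1 j) //= mxE nj mul0r mulr0.
Qed.

End Laplace.

(** * Koszul complexes *)

Section ShiftedProduct.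
Variables (K : nzRingType) (U : lmodType K).

(** The operator product (f - z)(f - z - 1)...(f - z - m + 1), a shifted falling factorial of
    [f]. *)
Fixpoint falling (f : U -> U) (z m : nat) (u : U) : U :=
  if m is m'.+1 then f (falling f z m' u) - (z + m')%:R *: falling f z m' u
  else u.

Lemma fallingS (f : {linear U -> U}) z m u :
  falling f z m.+1 u = falling f z.+1 m (f u - z%:R *: u).
Proof.
elim: m => [|m IH]; first by rewrite /= addn0.
by rewrite -[LHS]/(f (falling f z m.+1 u) - (z + m.+1)%:R *: falling f z m.+1 u)
  IH addnS -addSn.
Qed.

Lemma fallingD (f : {linear U -> U}) z m u v :
  falling f z m (u + v) = falling f z m u + falling f z m v.
Proof.
elim: m => [|m IH] //=; rewrite IH linearD scalerDr opprD.
by rewrite !addrA; congr (_ + _); rewrite addrAC.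
Qed.

End ShiftedProduct.

Section CommutingIdempotents.
Variables (K : closedFieldType) (U : lmodType K) (I : Type) (n : I -> {linear U -> U}).
Variable S : U -> Prop.
Hypotheses (sS : is_submod S) (Sn : forall i u, S u -> S (n i u)).
Hypothesis n_idem : forall i u, S u -> n i (n i u) = n i u.
Hypothesis n_comm : forall i j u, S u -> n i (n j u) = n j (n i u).

Definition idsum (r : seq I) (u : U) := \sum_(i <- r) n i u.

Lemma idsum_linear r : linear (idsum r).
Proof.
move=> a u v; rewrite /idsum scaler_sumr -big_split /=; apply: eq_bigr => i _.
by rewrite linearP.
Qed.

HB.instance Definition _ r :=
  GRing.isLinear.Build K U U *:%R (idsum r) (idsum_linear r).

(** The commuting [n j] preserve the eigenspace of [n i] for [e]; there the summand [n i] acts as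
    [e] and cancels the shift of [z]. *)
Lemma falling_eigen i r e z m u : S u -> n i u = e%:R *: u ->
  [/\ falling (idsum (i :: r)) (e + z) m u = falling (idsum r) z m u,
      S (falling (idsum r) z m u) &
      n i (falling (idsum r) z m u) = e%:R *: falling (idsum r) z m u].
Proof.
move=> Su nu; elim: m => [|m [IH1 IH2 IH3]] //=; rewrite IH1.
set w := falling _ z m u in IH1 IH2 IH3 *.
have SN : S (idsum r w) by apply: is_submod_sum => // j; apply: Sn.
split.
- rewrite /idsum big_cons IH3 -/(idsum r w) -addnA natrD scalerDl opprD addrACA.
  by rewrite subrr add0r.
- by apply: is_submodD => //; apply: is_submodN => //; apply: is_submodZ.
rewrite linearB linearZ /= IH3 scalerBr !scalerA -!natrM mulnC; congr (_ - _).
rewrite /idsum linear_sum scaler_sumr; apply: eq_bigr => j _.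
by rewrite n_comm // IH3 linearZ.
Qed.

(** A sum of r commuting idempotents has its eigenvalues among 0, ..., r. Splitting [u] into
    eigencomponents of [n i] removes one idempotent at a time. *)
Lemma falling_idsum r u : S u -> falling (idsum r) 0 (size r).+1 u = 0.
Proof.
elim: r u => [|i r IH] u Su.
  by rewrite /= /idsum big_nil scale0r subrr.
have -> : u = n i u + (u - n i u) by rewrite addrC subrK.
have Snu := Sn i Su.
have ev e x : S x -> n i x = e%:R *: x ->
    S (idsum (i :: r) x) /\ n i (idsum (i :: r) x) = e%:R *: idsum (i :: r) x.
  move=> Sx nx; split; first by apply: is_submod_sum => // j; apply: Sn.
  rewrite /idsum linear_sum scaler_sumr; apply: eq_bigr => j _.
  by rewrite n_comm // nx linearZ.
(* For eigenvalue 1 the factor at 0 is spent first; the remaining factors start at 1 and reduce to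
   the product for [r]. *)
have E1 : falling (idsum (i :: r)) 0 (size r).+2 (n i u) = 0.
  have [||Sy ny] := ev 1%N (n i u); [by [] | by rewrite n_idem // scale1r |].
  rewrite fallingS scale0r subr0.
  by have [-> _ _] := falling_eigen r 0 (size r).+1 Sy ny; apply: IH.
have E0 : falling (idsum (i :: r)) 0 (size r).+1 (u - n i u) = 0.
  have Sx : S (u - n i u) by apply: is_submodD => //; apply: is_submodN.
  have nx : n i (u - n i u) = 0%:R *: (u - n i u).
    by rewrite scale0r linearB /= n_idem // subrr.
  by have [-> _ _] := falling_eigen r 0 (size r).+1 Sx nx; apply: IH.
rewrite fallingD [X in X + _]E1 add0r.
by rewrite -[LHS]/(idsum (i :: r) (falling (idsum (i :: r)) 0 (size r).+1 (u - n i u))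
  - _ *: falling (idsum (i :: r)) 0 (size r).+1 (u - n i u)) E0 linear0 scaler0 subrr.
Qed.
End CommutingIdempotents.

(* An abstract Koszul complex: [a], [w] are odd annihilation and creation
   operators, [d], [y] even ones; [h = sum y a] contracts [D = sum w d] up to
   the number operator [N + E]. *)
Section Koszul.
Variables (K : numClosedFieldType) (U : lmodType K) (I : finType).
Variables w a d y : I -> {linear U -> U}.
Hypothesis aw : forall i j u, a i (w j u) = (if i == j then u else 0) - w j (a i u).
Hypothesis dy : forall i j u, d i (y j u) = (if i == j then u else 0) + y j (d i u).
Hypothesis ww : forall i j u, w i (w j u) = - w j (w i u).
Hypothesis wd : forall i j u, d i (w j u) = w j (d i u).
Hypothesis wy : forall i j u, y i (w j u) = w j (y i u).
Hypothesis ad : forall i j u, a i (d j u) = d j (a i u).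
Variable S : U -> Prop.
Hypotheses (sS : is_submod S) (Sa : forall i u, S u -> S (a i u))
  (Sw : forall i u, S u -> S (w i u)) (Sy : forall i u, S u -> S (y i u)).
(** In the application these two relations need alternating, respectively symmetric, tensors, hence
    the restriction to [S]. *)
Hypothesis aa : forall i j u, S u -> a i (a j u) = - a j (a i u).
Hypothesis dd : forall i j u, S u -> d i (d j u) = d j (d i u).

Definition kos_d u := \sum_i w i (d i u).
Definition kos_h u := \sum_i y i (a i u).
Definition kos_n u := \sum_i w i (a i u).
Definition kos_e u := \sum_i y i (d i u).

(** The double sums of w y d a in the two composites cancel; the diagonal terms of [dy] and [aw]
    leave N and E. *)
Lemma kos_homotopy u : kos_d (kos_h u) + kos_h (kos_d u) = kos_n u + kos_e u.
Proof.
have -> : kos_d (kos_h u) = kos_n u + \sum_i \sum_j w i (y j (d i (a j u))).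
  rewrite /kos_d /kos_n -big_split /=; apply: eq_bigr => i _.
  rewrite /kos_h !linear_sum (eq_bigr (fun j => w i (if i == j then a j u else 0)
     + w i (y j (d i (a j u))))); last by move=> j _; rewrite dy linearD.
  rewrite big_split /= (bigD1 i) //= eqxx big1 ?addr0 // => j ij.
  by rewrite eq_sym (negbTE ij) linear0.
have -> : kos_h (kos_d u) = kos_e u - \sum_i \sum_j w i (y j (d i (a j u))).
  rewrite exchange_big /kos_h /kos_e -sumrB /=; apply: eq_bigr => j _.
  rewrite /kos_d !linear_sum (eq_bigr (fun i => y j (if j == i then d i u else 0)
     - w i (y j (d i (a j u))))); last by move=> i _; rewrite aw linearB /= ad wy.
  rewrite big_split /= sumrN (bigD1 j) //= eqxx big1 ?addr0 // => i ij.
  by rewrite eq_sym (negbTE ij) linear0.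
by rewrite addrACA subrr addr0.
Qed.

Lemma kos_dB u v : kos_d (u + v) = kos_d u + kos_d v.
Proof. by rewrite -big_split; apply: eq_bigr => i _; rewrite !linearD. Qed.

Lemma kos_dZ c u : kos_d (c *: u) = c *: kos_d u.
Proof. by rewrite scaler_sumr; apply: eq_bigr => i _; rewrite !linearZ. Qed.

Lemma eqrN0 (u : U) : u = - u -> u = 0.
Proof.
move=> E; have : 2%:R *: u = 0 by rewrite scaler_nat mulr2n {1}E addNr.
by move/eqP; rewrite scaler_eq0 pnatr_eq0 => /eqP.
Qed.

Lemma kos_dd u : S u -> kos_d (kos_d u) = 0.
Proof.
move=> Su; apply: eqrN0.
have E : kos_d (kos_d u) = \sum_i \sum_j w i (w j (d i (d j u))).
  apply: eq_bigr => i _; rewrite !linear_sum; apply: eq_bigr => j _.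
  by rewrite wd.
rewrite {1}E exchange_big E -sumrN; apply: eq_bigr => i _.
by rewrite -sumrN; apply: eq_bigr => j _; rewrite ww dd.
Qed.

Let nop i : U -> U := fun u => w i (a i u).
Let nop_linear i : linear (nop i).
Proof. by move=> c u v; rewrite /nop !linearP. Qed.
HB.instance Definition _ i := GRing.isLinear.Build K U U *:%R (nop i) (nop_linear i).

(** The operators w_i a_i are idempotent because w_i squares to zero, and they commute because the
    signs from the anticommutation rules cancel. *)
Lemma kos_falling u : S u -> falling kos_n 0 #|I|.+1 u = 0.
Proof.
move=> Su.
have E : kos_n = idsum (fun i => (nop i : {linear U -> U})) (index_enum I) by [].
have -> : #|I| = size (index_enum I) by rewrite cardT enumT.
rewrite E; apply: (@falling_idsum _ _ _ _ S) => //.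
- by move=> i v Sv; apply/Sw/Sa.
- move=> i v Sv; rewrite /= /nop aw eqxx.
  by rewrite linearB /= [w i (w i _)]eqrN0 ?subr0 // ww.
move=> i j v Sv; case: (eqVneq i j) => [->//|ij]; rewrite /= /nop.
rewrite !aw (negbTE ij) eq_sym (negbTE ij) !sub0r !linearN /=.
by rewrite aa // linearN /= linearN /= [in RHS]ww opprK.
Qed.

(* On closed elements [N] acts as [- m.+1] modulo the image of [D], whereas [N]
   is a sum of commuting idempotents, so that its eigenvalues are >= 0. *)
Lemma koszul_exact (Gp Gq : U -> Prop) m v :
    is_submod Gp -> is_submod Gq -> (forall u, Gp u -> S u) ->
    (forall u, Gp u -> Gq (kos_h u)) -> (forall u, Gp u -> Gp (kos_n u)) ->
    (forall u, Gp u -> kos_e u = m.+1%:R *: u) ->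
  Gp v -> kos_d v = 0 -> exists2 u, Gq u & kos_d u = v.
Proof.
move=> sGp sGq GS Gh Gn Ge Gv dv.
have Sh u : S u -> S (kos_h u).
  by move=> Su; apply: is_submod_sum => // i; apply/Sy/Sa.
pose x := falling kos_n 0 ^~ v.
(* Invariant: [x k] is closed and is a nonzero multiple of [v] modulo the image of D. Each step
   multiplies the scalar by -(m + 1 + k), and [x #|I|.+1] vanishes. *)
suff main k : [/\ Gp (x k), kos_d (x k) = 0 &
    exists c u, [/\ c != 0, Gq u & x k = c *: v + kos_d u]].
  have [_ _ [c [u [c0 Gu]]]] := main #|I|.+1.
  rewrite /x kos_falling; last exact: GS.
  move/esym/eqP; rewrite addr_eq0 => /eqP E; exists (- c^-1 *: u).
    exact: is_submodZ.
  by rewrite kos_dZ scaleNr -scalerN -E scalerA mulVf ?scale1r.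
elim: k => [|k [Gx dx [c [u [c0 Gu xE]]]]].
  split=> //; exists 1, 0; split; [exact: oner_neq0 | by case: sGq |].
  by rewrite scale1r /kos_d big1 ?addr0 // => i _; rewrite !linear0.
have nx : kos_n (x k) = kos_d (kos_h (x k)) - m.+1%:R *: x k.
  rewrite -Ge //; apply/eqP; rewrite eq_sym subr_eq -kos_homotopy dx.
  by rewrite [kos_h 0]/kos_h big1 ?addr0 // => i _; rewrite !linear0.
have xS : x k.+1 = - (m.+1 + k)%:R *: x k + kos_d (kos_h (x k)).
  rewrite -[x k.+1]/(kos_n (x k) - (0 + k)%:R *: x k) nx add0n natrD.
  by rewrite opprD scalerDl !scaleNr addrC addrA addrAC; congr (_ + _); rewrite addrC.
split.
- by apply: is_submodD => //; [apply: Gn | apply: is_submodN => //; apply: is_submodZ].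
- by rewrite xS kos_dB kos_dZ dx scaler0 add0r kos_dd //; apply/Sh/GS.
exists (- (m.+1 + k)%:R * c), (- (m.+1 + k)%:R *: u + kos_h (x k)); split.
- by rewrite mulf_neq0 // oppr_eq0 pnatr_eq0 addSn.
- by apply: is_submodD => //; [apply: is_submodZ | apply: Gh].
by rewrite xS {1}xE kos_dB kos_dZ scalerDr scalerA addrA.
Qed.

End Koszul.

(** * The action on tensors *)

Section Tensors.
Variables (K : numClosedFieldType) (b c : nat).

(* Coordinates of elements of Lambda C (x) S B inside the tensor algebras, on
   all basis words [t] in C and [s] in B. *)
Local Notation tensor := (seq 'I_c -> seq 'I_b -> K^o).

Lemma tensor_eq (u v : tensor) : (forall t s, u t s = v t s) -> u = v.
Proof. by move=> E; apply/funeq2P => t s; apply: E. Qed.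

Lemma tensor_sumE (I : Type) (r : seq I) (F : I -> tensor) t s :
  (\sum_(i <- r) F i) t s = \sum_(i <- r) F i t s.
Proof. by rewrite !fct_sumE. Qed.

Definition behead1 (k : 'I_c) (u : tensor) : tensor := fun t => u (k :: t).
Definition behead2 (j : 'I_b) (u : tensor) : tensor := fun t s => u t (j :: s).

(** Exterior multiplication by [x]: the alternating sum over the letters of [t], each deleted in
    turn and paired with its coordinate of [x]. *)
Fixpoint wedge (x : 'rV[K]_c) (u : tensor) (t : seq 'I_c) : seq 'I_b -> K^o :=
  if t is k :: t' then fun s => x 0 k * u t' s - wedge x (behead1 k u) t' s
  else 0.

(** The sum over occurrences of [j] in [s], each deleted in turn: multiplication by b_j, in the
    normalisation where [behead2 j] is the derivative d/db_j. *)
Fixpoint symcons (j : 'I_b) (f : seq 'I_b -> K^o) (s : seq 'I_b) : K^o :=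
  if s is i :: s' then
    (if i == j then f s' else 0) + symcons j (fun s'' => f (i :: s'')) s'
  else 0.

Definition symmul (j : 'I_b) (u : tensor) : tensor := fun t => symcons j (u t).

Lemma behead1_linear k : linear (behead1 k).
Proof. by []. Qed.

Lemma behead1_sum k (I : finType) (F : I -> tensor) :
  behead1 k (\sum_i F i) = \sum_i behead1 k (F i).
Proof. by apply: tensor_eq => t s; rewrite /behead1 !tensor_sumE. Qed.

Lemma behead2_linear j : linear (behead2 j).
Proof. by []. Qed.

Lemma wedge_linear x : linear (wedge x : tensor -> tensor).
Proof.
move=> a u v; apply: tensor_eq => t s; elim: t u v => [|k t IH] u v /=.
  by rewrite -[RHS]/(a * 0 + 0) mulr0 addr0.
rewrite -[RHS]/(a * (x 0 k * u t s - wedge x (behead1 k u) t s) +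
   (x 0 k * v t s - wedge x (behead1 k v) t s)).
rewrite behead1_linear IH -[(_ + _) t s]/(a * u t s + v t s).
rewrite -[(_ + _) t s]/(a * wedge x (behead1 k u) t s + wedge x (behead1 k v) t s).
by rewrite mulrDr opprD addrACA mulrBr !mulrA [a * x _ _]mulrC.
Qed.

Lemma symcons_linear j a f g s :
  symcons j (fun s => a * f s + g s) s = a * symcons j f s + symcons j g s.
Proof.
elim: s f g => [|i s IH] f g /=; first by rewrite mulr0 addr0.
rewrite IH mulrDr addrACA; case: eqP => // _; by rewrite mulr0 addr0.
Qed.

Lemma symmul_linear j : linear (symmul j).
Proof. by move=> a u v; apply: tensor_eq => t s; apply: symcons_linear. Qed.

HB.instance Definition _ k :=
  GRing.isLinear.Build K tensor tensor *:%R (behead1 k) (behead1_linear k).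
HB.instance Definition _ j :=
  GRing.isLinear.Build K tensor tensor *:%R (behead2 j) (behead2_linear j).
HB.instance Definition _ x :=
  GRing.isLinear.Build K tensor tensor *:%R (wedge x) (wedge_linear x).
HB.instance Definition _ j :=
  GRing.isLinear.Build K tensor tensor *:%R (symmul j) (symmul_linear j).

Lemma behead2_sum j (I : finType) (F : I -> tensor) :
  behead2 j (\sum_i F i) = \sum_i behead2 j (F i).
Proof. by apply: tensor_eq => t s; rewrite /behead2 !tensor_sumE. Qed.

Lemma wedge_sum x (I : finType) (F : I -> tensor) :
  wedge x (\sum_i F i) = \sum_i wedge x (F i).
Proof. exact: linear_sum. Qed.

Lemma wedgeZ x a u : wedge x (a *: u) = a *: wedge x u.
Proof. exact: linearZ. Qed.

Lemma wedge_linearl a x y u : wedge (a *: x + y) u = a *: wedge x u + wedge y u :> tensor.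
Proof.
apply: tensor_eq => t s; elim: t u => [|k t IH] u.
  by rewrite -[RHS]/(a * 0 + 0) mulr0 addr0.
rewrite -[RHS]/(a * (x 0 k * u t s - wedge x (behead1 k u) t s) +
   (y 0 k * u t s - wedge y (behead1 k u) t s)) /= IH !mxE.
rewrite -[(_ + _) t s]/(a * wedge x (behead1 k u) t s + wedge y (behead1 k u) t s).
by rewrite mulrDl opprD addrACA mulrBr !mulrA.
Qed.

Lemma behead1_wedge k x u : behead1 k (wedge x u) = x 0 k *: u - wedge x (behead1 k u).
Proof. by []. Qed.

Lemma wedgeC x y u : wedge x (wedge y u) = - wedge y (wedge x u) :> tensor.
Proof.
apply: tensor_eq => t s; elim: t u => [|k t IH] u.
  by rewrite -[RHS]/(- (0 : K)) oppr0.
rewrite -[RHS]/(- (y 0 k * wedge x u t s - wedge y (behead1 k (wedge x u)) t s)) /=.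
have E z w v1 v2 : wedge z (w *: v1 - v2) t s = w * wedge z v1 t s - wedge z v2 t s.
  by rewrite linearB linearZ.
rewrite !behead1_wedge !E IH -[(- wedge y _) t s]/(- wedge y (wedge x (behead1 k u)) t s).
set p := wedge y _ t s; set q := wedge x _ t s; set r := wedge y (wedge _ _) t s.
by rewrite !opprD !opprK !addrA; congr (_ - r); rewrite addrC.
Qed.

Lemma behead2_wedge j x u : behead2 j (wedge x u) = wedge x (behead2 j u).
Proof.
apply: tensor_eq => t s; elim: t u => [|k t IH] u; first by [].
by rewrite -[RHS]/(x 0 k * behead2 j u t s - wedge x (behead2 j (behead1 k u)) t s) -IH.
Qed.

Lemma symmul_wedge j x u : symmul j (wedge x u) = wedge x (symmul j u).
Proof.
apply: tensor_eq => t s; elim: t u => [|k t IH] u.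
  rewrite /symmul /=; elim: s => //= i s ->.
  by rewrite addr0 if_same.
rewrite -[RHS]/(x 0 k * symmul j u t s - wedge x (symmul j (behead1 k u)) t s) -IH.
rewrite /symmul.
have -> : wedge x u (k :: t) =
    fun s => x 0 k * u t s + (fun s => - wedge x (behead1 k u) t s) s by [].
rewrite symcons_linear; congr (_ + _).
have := symcons_linear j (-1) (wedge x (behead1 k u) t) (fun=> 0) s.
have -> : symcons j (fun=> 0) s = 0 by elim: s {IH} => //= i s ->; rewrite if_same addr0.
rewrite mulN1r addr0 => <-; congr (symcons _ _ _); apply/funext => s'.
by rewrite mulN1r addr0.
Qed.

Lemma behead2_symmul i j u :
  behead2 i (symmul j u) = (if i == j then u else 0) + symmul j (behead2 i u).
Proof. by apply: tensor_eq => t s; rewrite /behead2 /symmul /=; case: eqP. Qed.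

Definition alternating (u : tensor) :=
  forall r k l t s, u (r ++ k :: l :: t) s = - u (r ++ l :: k :: t) s.
Definition symmetric_word (u : tensor) :=
  forall t r i j s, u t (r ++ i :: j :: s) = u t (r ++ j :: i :: s).
Definition altsym u := alternating u /\ symmetric_word u.

Lemma altsym_submod : is_submod altsym.
Proof.
split; first by split=> [r k l t s|t r i j s] //; rewrite -[LHS]/(0 : K) -[RHS]/(- 0 : K) oppr0.
move=> a u v [Au Su] [Av Sv]; split=> [r k l t s|t r i j s].
  rewrite -[LHS]/(a * u (r ++ k :: l :: t) s + v (r ++ k :: l :: t) s) Au Av.
  by rewrite mulrN -opprD.
by rewrite -[LHS]/(a * u t (r ++ i :: j :: s) + v t (r ++ i :: j :: s)) Su Sv.
Qed.

Lemma altsym_behead1 k u : altsym u -> altsym (behead1 k u).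
Proof.
move=> [Au Su]; split=> [r l m t s|t r i j s]; first exact: (Au (k :: r)).
exact: Su.
Qed.

Lemma altsym_behead2 j u : altsym u -> altsym (behead2 j u).
Proof.
move=> [Au Su]; split=> [r l m t s|t r i k s]; first exact: Au.
exact: (Su t (j :: r)).
Qed.

Lemma behead1C k l u : altsym u -> behead1 k (behead1 l u) = - behead1 l (behead1 k u).
Proof. by move=> [Au _]; apply: tensor_eq => t s; apply: (Au [::] l k t s). Qed.

Lemma behead2C i j u : altsym u -> behead2 i (behead2 j u) = behead2 j (behead2 i u).
Proof. by move=> [_ Su]; apply: tensor_eq => t s; apply: (Su t [::] j i s). Qed.

Lemma altsym_wedge x u : altsym u -> altsym (wedge x u).
Proof.
move=> asu; split=> [r k l t s|t r i j s].
  elim: r u asu => [|m r IH] u asu /=.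
    rewrite (behead1C k l asu) linearN -[(- _ : tensor) t s]/(- wedge x (behead1 l (behead1 k u)) t s).
    by rewrite !opprB !opprK addrA.
  by rewrite IH ?opprB ?opprK; [rewrite (proj1 asu); rewrite mulrN addrC | exact: altsym_behead1].
elim: t u asu => [|k t IH] u asu //=.
by rewrite IH; [rewrite (proj2 asu) | exact: altsym_behead1].
Qed.

Lemma altsym_symmul j u : altsym u -> altsym (symmul j u).
Proof.
move=> [Au Su]; split=> [r k l t s|t r i k s]; rewrite /symmul.
  have := symcons_linear j (-1) (u (r ++ l :: k :: t)) (fun=> 0) s.
  have -> : symcons j (fun=> 0) s = 0 by elim: s => //= i s ->; rewrite if_same addr0.
  rewrite mulN1r addr0 => <-; congr (symcons _ _ _); apply/funext => s'.
  by rewrite mulN1r addr0 Au.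
have : forall r i k s, u t (r ++ i :: k :: s) = u t (r ++ k :: i :: s) by move=> *; apply: Su.
elim: r (u t) => [|m r IH] f fS /=; last by rewrite fS IH // => r' *; apply: (fS (m :: r')).
rewrite !addrA; congr (_ + _); last first.
  by congr (symcons _ _ _); apply/funext => s'; apply: (fS [::]).
by rewrite addrC.
Qed.

(** Euler's identity for the symmetric degree. *)
Lemma symmul_behead2_sum u t s : altsym u ->
  (\sum_j symmul j (behead2 j u)) t s = (size s)%:R * u t s.
Proof.
move=> asu; rewrite tensor_sumE; elim: s u asu => [|i s IH] u asu.
  by rewrite mul0r big1.
rewrite -[size (i :: s)]/(1 + size s)%N /symmul big_split /= natrD mulrDl mul1r.
congr (_ + _).
  by rewrite (bigD1 i) //= eqxx big1 ?addr0 // => j; rewrite eq_sym => /negbTE ->.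
rewrite -[u t (i :: s)]/(behead2 i u t s) -IH; last exact: altsym_behead2.
apply: eq_bigr => j _; congr (symcons _ _ _); apply/funext => s'.
by rewrite behead2C.
Qed.

Lemma wedge_support x u t s :
  (forall t', (size t').+1 = size t -> u t' s = 0) -> wedge x u t s = 0.
Proof.
elim: t u => [|k t IH] u H //=; rewrite H // mulr0 IH ?subr0 // => t' E.
by apply: H; rewrite /= E.
Qed.

Lemma symcons_support j f s :
  (forall s', (size s').+1 = size s -> f s' = 0) -> symcons j f s = 0.
Proof.
elim: s f => [|i s IH] f H //=; rewrite H // if_same IH ?addr0 // => s' E.
by apply: H; rewrite /= E.
Qed.

End Tensors.

(** * The Koszul differential on tensors and its exactness *)

Section TensorKoszul.
Variables (K : numClosedFieldType) (b c : nat).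
Local Notation tensor := (seq 'I_c -> seq 'I_b -> K^o).

(** When [C *m P = 1], these contractions are dual to wedging with the rows of [C]. *)
Definition contract (P : 'M[K]_(c, b)) (j : 'I_b) (u : tensor) : tensor :=
  \sum_k P k j *: behead1 k u.

Lemma contract_linear P j : linear (contract P j).
Proof.
move=> a u v; rewrite /contract scaler_sumr -big_split /=; apply: eq_bigr => k _.
by rewrite behead1_linear scalerDr !scalerA mulrC.
Qed.

HB.instance Definition _ P j :=
  GRing.isLinear.Build K tensor tensor *:%R (contract P j) (contract_linear P j).

(** This is D_alpha when row j of [C] is gamma(alpha (x) b_j). *)
Definition koszul_map (C : 'M[K]_(b, c)) (u : tensor) : tensor :=
  \sum_j wedge (row j C) (behead2 j u).

Lemma koszul_map_linear C : linear (koszul_map C).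
Proof.
move=> a u v; rewrite /koszul_map scaler_sumr -big_split /=; apply: eq_bigr => k _.
by rewrite behead2_linear wedge_linear.
Qed.

HB.instance Definition _ C :=
  GRing.isLinear.Build K tensor tensor *:%R (koszul_map C) (koszul_map_linear C).

Lemma koszul_map_linearl a C C' u :
  koszul_map (a *: C + C') u = a *: koszul_map C u + koszul_map C' u.
Proof.
rewrite /koszul_map scaler_sumr -big_split /=; apply: eq_bigr => k _.
have -> : row k (a *: C + C') = a *: row k C + row k C'.
  by apply/rowP => i; rewrite !mxE.
by rewrite wedge_linearl.
Qed.

Lemma koszul_map_suml k (lam : nat -> K) (C : nat -> 'M[K]_(b, c)) u :
  koszul_map (\sum_(i < k) lam i *: C i) u = \sum_(i < k) lam i *: koszul_map (C i) u.
Proof.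
elim: k => [|k IH]; last by rewrite !big_ord_recr /= addrC koszul_map_linearl IH addrC.
rewrite !big_ord0; have := koszul_map_linearl (-1) 0 0 u.
by rewrite scaler0 addr0 scaleN1r addNr.
Qed.

Lemma altsym_koszul_map C u : altsym u -> altsym (koszul_map C u).
Proof.
move=> Su; apply: is_submod_sum; first exact: altsym_submod.
by move=> j; apply/altsym_wedge/altsym_behead2.
Qed.

Lemma koszul_map_anti C C' u : altsym u ->
  koszul_map C (koszul_map C' u) = - koszul_map C' (koszul_map C u).
Proof.
move=> Su.
have E A B : koszul_map A (koszul_map B u) =
    \sum_i \sum_j wedge (row i A) (wedge (row j B) (behead2 i (behead2 j u))).
  apply: eq_bigr => i _; rewrite {1}/koszul_map behead2_sum wedge_sum.
  by apply: eq_bigr => j _; rewrite behead2_wedge.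
rewrite !E exchange_big -sumrN; apply: eq_bigr => i _ /=.
rewrite -sumrN; apply: eq_bigr => j _ /=.
by rewrite wedgeC behead2C.
Qed.

Lemma koszul_map_sq C u : altsym u -> koszul_map C (koszul_map C u) = 0.
Proof. by move=> Su; apply: eqrN0; apply: koszul_map_anti. Qed.

(* Total degree [n], with [p.-1] factors in C; [p = 0] is the zero space. *)
Definition graded n p (u : tensor) := altsym u /\
  forall t s, ~~ (((size t).+1 == p) && (size t + size s == n)%N) -> u t s = 0.

Lemma graded_submod n p : is_submod (graded n p).
Proof.
split=> [|a u v [Su Hu] [Sv Hv]]; first by split=> //; case: (altsym_submod K b c).
split=> [|t s H]; first by case: (altsym_submod K b c) => _; apply.
by rewrite -[LHS]/(a * u t s + v t s) Hu // Hv // mulr0 addr0.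
Qed.

Lemma graded_koszul_map n p C u : graded n p u -> graded n p.+1 (koszul_map C u).
Proof.
move=> [Su Hu]; split=> [|t s H]; first exact: altsym_koszul_map.
rewrite /koszul_map tensor_sumE big1 // => j _; apply: wedge_support => t' tt'.
apply: Hu; apply: contra H; rewrite -tt' /=.
by move=> /= /andP[/eqP <- /eqP <-]; rewrite addSnnS !eqxx.
Qed.

(** A right inverse of [C] supplies the contracting homotopy, and E acts as the symmetric degree n -
    p, which is positive. *)
Lemma koszul_map_exact n p (C : 'M[K]_(b, c)) v :
    row_free C -> (p < n)%N -> graded n p.+1 v -> koszul_map C v = 0 ->
  exists2 u, graded n p u & koszul_map C u = v.
Proof.
move=> fC pn Gv dv.
have /row_freeP[P CP] := fC.
pose w j : {linear tensor -> tensor} := wedge (row j C).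
pose a j : {linear tensor -> tensor} := contract P j.
pose d j : {linear tensor -> tensor} := @behead2 K b c j.
pose y j : {linear tensor -> tensor} := @symmul K b c j.
have mm : (n - p).-1.+1 = (n - p)%N by rewrite prednK // subn_gt0.
have aw i j u : a i (w j u) = (if i == j then u else 0) - w j (a i u).
  have -> : (if i == j then u else 0) = (C *m P) j i *: u.
    by rewrite CP mxE eq_sym; case: eqP; rewrite ?scale1r ?scale0r.
  rewrite mxE scaler_suml /= {2}/contract wedge_sum -sumrB; apply: eq_bigr => k _ /=.
  by rewrite behead1_wedge scalerBr scalerA wedgeZ mxE mulrC.
apply: (@koszul_exact K tensor _ w a d y aw _ _ _ _ _ (@altsym K b c)
  _ _ _ _ _ _ (graded n p.+1) (graded n p) (n - p).-1 v) => //.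
- by move=> i j u; apply: behead2_symmul.
- by move=> i j u; apply: wedgeC.
- by move=> i j u; apply: behead2_wedge.
- by move=> i j u; apply: symmul_wedge.
- by move=> i j u; rewrite /= /contract behead2_sum.
- exact: altsym_submod.
- move=> i u Su; apply: is_submod_sum => [|k]; first exact: altsym_submod.
  by apply: is_submodZ; [exact: altsym_submod | exact: altsym_behead1].
- by move=> i u; apply: altsym_wedge.
- by move=> i u; apply: altsym_symmul.
- have E i j u : a i (a j u) = \sum_k \sum_l (P k i * P l j) *: behead1 k (behead1 l u).
    apply: eq_bigr => k _; rewrite /= /contract behead1_sum scaler_sumr.
    by apply: eq_bigr => l _; rewrite -scalerA.
  move=> i j u Su; rewrite !E exchange_big -sumrN; apply: eq_bigr => k _ /=.
  by rewrite -sumrN; apply: eq_bigr => l _; rewrite behead1C // scalerN mulrC.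
- by move=> i j u; apply: behead2C.
- exact: graded_submod.
- exact: graded_submod.
- by move=> u [].
- move=> u [Su Hu]; split.
    apply: is_submod_sum => [|k]; first exact: altsym_submod.
    apply: altsym_symmul; apply: is_submod_sum => [|l]; first exact: altsym_submod.
    by apply: is_submodZ; [exact: altsym_submod | exact: altsym_behead1].
  move=> t s H; rewrite /kos_h tensor_sumE big1 // => j _; apply: symcons_support => s' E.
  rewrite /= /contract tensor_sumE big1 // => k _.
  rewrite -[LHS]/(P k j * u (k :: t) s') Hu ?mulr0 //.
  by apply: contra H; rewrite -E /= eqSS addnS addSn.
- move=> u [Su Hu]; split.
    apply: is_submod_sum => [|k]; first exact: altsym_submod.
    apply: altsym_wedge; apply: is_submod_sum => [|l]; first exact: altsym_submod.
    by apply: is_submodZ; [exact: altsym_submod | exact: altsym_behead1].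
  move=> t s H; rewrite /kos_n tensor_sumE big1 // => j _; apply: wedge_support => t' E.
  rewrite /= /contract tensor_sumE big1 // => k _.
  by rewrite -[LHS]/(P k j * u (k :: t') s) Hu ?mulr0 //= E.
move=> u [Su Hu]; rewrite mm; apply: tensor_eq => t s.
rewrite -[LHS]/((\sum_j symmul j (behead2 j u)) t s) symmul_behead2_sum //.
rewrite -[RHS]/((n - p)%:R * u t s).
case: (boolP (((size t).+1 == p.+1) && (size t + size s == n)%N)) => [|H].
  by rewrite eqSS => /andP[/eqP <- /eqP <-]; rewrite addKn.
by rewrite Hu // !mulr0.
Qed.

Lemma graded_finite_rank n p : finite_rank (graded n p).
Proof.
move=> v Gv.
(* An element of [graded n p] is determined by its values on the finitely many word pairs in [X], so
   one vector more than #|X| forces a dependency. *)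
pose X : finType := (p.-1.-tuple 'I_c * (n - p.-1).-tuple 'I_b)%type.
pose A : 'M[K]_(#|X|.+1, #|X|) :=
  \matrix_(i, j) let x : X := enum_val j in v i (val x.1) (val x.2).
have : kermx A != 0.
  by rewrite kermx_eq0 /row_free neq_ltn ltnS rank_leq_col.
move=> /rowV0Pn[x /sub_kermxP xA x0].
exists #|X|.+1, (rVpoly x); split.
- by apply: contraNneq x0 => E; rewrite -[x]rVpolyK E linear0.
- exact: size_poly.
apply: tensor_eq => t s; rewrite tensor_sumE.
case: (boolP (((size t).+1 == p) && (size t + size s == n)%N)) => [|H]; last first.
  rewrite big1 // => i _; have [_ Hi] := Gv i.
  by rewrite -[LHS]/((rVpoly x)`_i * v i t s) Hi ?mulr0.
move=> /andP[/eqP tp /eqP ts].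
have st : size t == p.-1 by rewrite -tp.
have ss : size s == (n - p.-1)%N by rewrite -tp -ts addKn.
have := congr1 (fun M : 'rV_#|X| => M 0 (enum_rank ((Tuple st, Tuple ss) : X))) xA.
rewrite !mxE => E; rewrite -[RHS]E; apply: eq_bigr => i _.
by rewrite mxE enum_rankK coef_rVpoly_ord.
Qed.

(** The recursion is unfolded so as to match the expansion of a determinant along its first row. *)
Lemma wedge_expansion r (T : 'I_r.+1 -> 'I_c) x (u : tensor) s :
  wedge x u (map T (enum 'I_r.+1)) s =
  \sum_(l < r.+1) (-1) ^+ l * x 0 (T l) * u (map (T \o lift l) (enum 'I_r)) s.
Proof.
elim: r T u => [|r IH] T u.
  rewrite enum_ordSl big_ord1 /= expr0 mul1r.
  have -> : enum 'I_0 = [::] by apply/eqP; rewrite -size_eq0 size_enum_ord.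
  by rewrite -[X in _ - X]/(0 : K) subr0.
have E l : map (T \o lift (lift ord0 l)) (enum 'I_r.+1) =
    T ord0 :: map ((T \o lift ord0) \o lift l) (enum 'I_r).
  rewrite enum_ordSl map_cons -map_comp; congr (_ :: _).
    by congr T; apply: val_inj.
  by apply: eq_map => i /=; congr T; apply: val_inj; rewrite /= bumpS.
rewrite big_ord_recl [in LHS]enum_ordSl map_cons -map_comp expr0 mul1r.
rewrite -[LHS]/(x 0 (T ord0) * u (map (T \o lift ord0) (enum 'I_r.+1)) s
  - wedge x (behead1 (T ord0) u) (map (T \o lift ord0) (enum 'I_r.+1)) s).
congr (_ + _); rewrite IH -sumrN; apply: eq_bigr => l _.
by rewrite E lift0 exprS !mulNr mul1r.
Qed.

End TensorKoszul.

(** * Exterior minors as coordinates of a product of Koszul differentials *)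

Definition ffcons (I : Type) r (j : I) (J : {ffun 'I_r -> I}) : {ffun 'I_r.+1 -> I} :=
  [ffun i => if unlift ord0 i is Some i' then J i' else j].

Lemma ffcons0 (I : Type) r (j : I) (J : {ffun 'I_r -> I}) : ffcons j J ord0 = j.
Proof. by rewrite ffunE unlift_none. Qed.

Lemma ffconsS (I : Type) r (j : I) (J : {ffun 'I_r -> I}) i :
  ffcons j J (lift ord0 i) = J i.
Proof. by rewrite ffunE liftK. Qed.

Lemma big_ffcons (V : nmodType) (I : finType) r (F : {ffun 'I_r.+1 -> I} -> V) :
  \sum_J F J = \sum_j \sum_J F (ffcons j J).
Proof.
rewrite pair_bigA /= (reindex (fun p => ffcons p.1 p.2)) //=.
exists (fun J => (J ord0, [ffun i => J (lift ord0 i)])) => [[j J]|J] _ /=.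
  by rewrite ffcons0; congr (_, _); apply/ffunP => i; rewrite ffunE ffconsS.
by apply/ffunP => i; case: (unliftP ord0 i) => [i' ->|->]; rewrite ?ffcons0 ?ffconsS ?ffunE.
Qed.

Section ExteriorMinors.
Variables (K : numClosedFieldType) (b c : nat).
Local Notation tensor := (seq 'I_c -> seq 'I_b -> K^o).

(** Each differential contributes one row of the determinant and one derivative. The outermost
    derivative prepends its letter to [s] first, so [J] comes out reversed. *)
Lemma koszul_product_coord (C : nat -> 'M[K]_(b, c)) (u : tensor) r m
    (T : 'I_r -> 'I_c) s : (forall t s, t != [::] -> u t s = 0) ->
  foldr (fun i => koszul_map (C i)) u (iota m r) (map T (enum 'I_r)) s =
  \sum_(J : {ffun 'I_r -> 'I_b})
     \det (\matrix_(k, l) C (m + k)%N (J k) (T l))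
     * u [::] (rev (map J (enum 'I_r)) ++ s).
Proof.
move=> u0; elim: r m T s => [|r IH] m T s.
  have e0 : enum 'I_0 = [::] by apply/eqP; rewrite -size_eq0 size_enum_ord.
  rewrite e0 /= (eq_bigr (fun=> u [::] s)); last by move=> J _; rewrite det_mx00 mul1r.
  by rewrite sumr_const card_ffun !card_ord expn0 mulr1n.
rewrite /= {1}/koszul_map tensor_sumE big_ffcons; apply: eq_bigr => j _.
rewrite wedge_expansion.
transitivity (\sum_(l < r.+1) \sum_(J : {ffun 'I_r -> 'I_b}) (-1) ^+ l * C m j (T l) *
   (\det (\matrix_(k, l') C (m.+1 + k)%N (J k) (T (lift l l')))
     * u [::] (rev (map J (enum 'I_r)) ++ j :: s))).
  by apply: eq_bigr => l _; rewrite mxE /behead2 IH mulr_sumr.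
rewrite exchange_big; apply: eq_bigr => J _ /=.
rewrite (expand_det_row _ ord0) mulr_suml; apply: eq_bigr => l _.
have -> : cofactor (\matrix_(k, l0) C (m + k)%N (ffcons j J k) (T l0)) ord0 l =
    (-1) ^+ l * \det (\matrix_(k, l') C (m.+1 + k)%N (J k) (T (lift l l'))).
  rewrite /cofactor add0n; congr (_ * \det _); apply/matrixP => i k.
  by rewrite !mxE ffconsS lift0 addnS.
rewrite mxE ffcons0 addn0 !mulrA [C m j _ * _]mulrC; congr (_ * _).
rewrite enum_ordSl /= ffcons0 rev_cons cat_rcons -map_comp.
by congr (u _ (rev _ ++ _)); apply: eq_map => i; rewrite /= ffconsS.
Qed.

Definition tensor_of r (q : {ffun 'I_r -> 'I_b} -> K) : tensor := fun t s =>
  if t is [::] then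
    if insub s is Some w then q [ffun i => tnth (w : r.-tuple 'I_b) i] else 0
  else 0.

Lemma tensor_of_perm r (q : {ffun 'I_r -> 'I_b} -> K) t s s' :
  symmetric_tensor q -> perm_eq s s' -> tensor_of q t s = tensor_of q t s'.
Proof.
move=> Sq ss'; case: t => //=; case: insubP => [w _ ws|ns]; last first.
  by rewrite insubF // -(perm_size ss'); apply: negbTE.
have szs : size s' == r by rewrite -(perm_size ss') -ws size_tuple.
case: insubP => [w' _ ws'|]; last by rewrite szs.
move: ss'; rewrite -ws -ws' => /tuple_permP[p pE].
rewrite -[RHS](Sq p); congr q; apply/ffunP => i; rewrite !ffunE.
by rewrite (val_inj (pE : val w = val [tuple tnth w' (p i) | i < r])) tnth_mktuple.
Qed.

Lemma tensor_of_map r (q : {ffun 'I_r -> 'I_b} -> K) (J : {ffun 'I_r -> 'I_b}) :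
  tensor_of q [::] (map J (enum 'I_r)) = q J.
Proof.
rewrite /tensor_of; case: insubP => [w _ wE|]; last by rewrite size_map size_enum_ord eqxx.
congr q; apply/ffunP => i; rewrite ffunE (tnth_nth (J i)) /= wE.
by rewrite (nth_map i) ?size_enum_ord // nth_ord_enum.
Qed.

Lemma tensor_of_graded r (q : {ffun 'I_r -> 'I_b} -> K) :
  symmetric_tensor q -> graded r 1 (tensor_of q).
Proof.
move=> Sq; split; last first.
  case=> [|k t] s //=; case: insubP => [w _ <-|] //.
  by rewrite size_tuple add0n eqxx.
split=> [l k k' t s|t l i j s].
  by case: l => [|k'' l]; rewrite /= oppr0.
by apply: tensor_of_perm => //; rewrite perm_cat2l -[i :: j :: s]/([:: i; j] ++ s)
  -[j :: i :: s]/([:: j; i] ++ s) perm_cat2r; apply: permEl (perm_catC [:: i] [:: j]).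
Qed.

Lemma det_columns_incr r (F : {ffun 'I_r -> 'I_c} -> K) :
    (forall T : {ffun 'I_r -> 'I_c}, ~~ injectiveb T -> F T = 0) ->
    (forall (T : {ffun 'I_r -> 'I_c}) (p : 'S_r), F [ffun i => T (p i)] = (-1) ^+ p * F T) ->
    (forall T, incr T -> F T = 0) ->
  forall T, F T = 0.
Proof.
move=> Falt Fperm Fincr T; case: (boolP (injectiveb T)) => [/injectiveP iT|]; last exact: Falt.
have [p /Fincr] := exists_sorting_perm iT; rewrite Fperm => /eqP.
by rewrite mulf_eq0 signr_eq0 => /eqP.
Qed.

(* Injectivity of e_r on Lambda^r A (x) S_r B for r = dim A. *)
Lemma exterior_minors_injective r (C : nat -> 'M[K]_(b, c))
    (q : {ffun 'I_r -> 'I_b} -> K) :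
    (forall lam : nat -> K, (exists2 i, (i < r)%N & lam i != 0) ->
       row_free (\sum_(i < r) lam i *: C i)) ->
    symmetric_tensor q ->
    (forall T : {ffun 'I_r -> 'I_c}, incr T ->
       \sum_J q J * \det (\matrix_(k < r, l < r) C k (J k) (T l)) = 0) ->
  forall J, q J = 0.
Proof.
move=> fC Sq q0.
have {}q0 : forall T : {ffun 'I_r -> 'I_c},
    \sum_J q J * \det (\matrix_(k < r, l < r) C k (J k) (T l)) = 0.
  apply: det_columns_incr => // T.
    move=> /injectivePn[l [l' ll' Tll']]; rewrite big1 // => J _.
    rewrite -det_tr (determinant_alternate ll') ?mulr0 // => k.
    by rewrite !mxE Tll'.
  move=> p; rewrite mulr_sumr; apply: eq_bigr => J _; rewrite mulrCA; congr (_ * _).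
  set M := \matrix_(k, l) C k (J k) (T l).
  have -> : \matrix_(k, l) C k (J k) ([ffun i => T (p i)] l) = col_perm p M.
    by apply/matrixP => k l; rewrite !mxE ffunE.
  by rewrite col_permE det_mulmx det_perm odd_permV mulrC.
pose D i : {linear tensor -> tensor} := koszul_map (C i).
suff E : tensor_of q = 0 by move=> J; rewrite -tensor_of_map E.
apply: (@top_product_injective _ tensor (@altsym K b c) r r (graded r) D) => //.
- exact: graded_submod.
- exact: graded_finite_rank.
- by move=> u [_ Hu]; apply: tensor_eq => t s; apply: Hu.
- by move=> p u [].
- by move=> i j u; apply: koszul_map_anti.
- by move=> i u; apply: koszul_map_sq.
- by move=> p i u _; apply: graded_koszul_map.
- move=> lam p v lam0 pr Gv; rewrite /lcomb /= -koszul_map_suml => dv.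
  have [u Gu uE] := koszul_map_exact (fC _ lam0) pr Gv dv.
  by exists u => //; rewrite -koszul_map_suml.
- exact: tensor_of_graded.
(* The top product lives on words [t] of length [r] with [s] empty, where its coordinates are the
   sums that vanish by [q0]. *)
apply: tensor_eq => t s.
have : graded r r.+1 (foldr (fun i w => D i w) (tensor_of q) (iota 0 r)).
  have G k m : graded r k.+1 (foldr (fun i w => D i w) (tensor_of q) (iota m k)).
    elim: k m => [|k IH] m; first exact: tensor_of_graded.
    by apply: graded_koszul_map; apply: IH.
  exact: G.
move=> [_ Hs]; case: (boolP (((size t).+1 == r.+1) && (size t + size s == r)%N)); last exact: Hs.
rewrite eqSS => /andP[/eqP tr]; rewrite tr -{2}[r]addn0 eqn_add2l size_eq0 => /eqP ->.
have -> : t = map (tnth (Tuple (introT eqP tr))) (enum 'I_r).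
  by rewrite map_tnth_enum.
rewrite koszul_product_coord; last by case.
rewrite -[RHS](q0 [ffun i => tnth (Tuple (introT eqP tr)) i]); apply: eq_bigr => J _.
rewrite mulrC cats0 (@tensor_of_perm _ _ _ _ (map J (enum 'I_r))) ?perm_rev //.
rewrite tensor_of_map; congr (_ * \det _); apply/matrixP => k l.
by rewrite !mxE ffunE.
Qed.

End ExteriorMinors.

(** * Syzygy schemes *)

Section SyzygyScheme.
Variable K : numClosedFieldType.

(** In the Leibniz term of a permutation s, reindexing [J] by s moves it from rows to columns, and
    symmetry of [q] absorbs the change. *)
Lemma sum_det_symmetric n b (q : {ffun 'I_n -> 'I_b} -> K) (A : 'I_n -> 'I_b -> 'I_n -> K) :
    symmetric_tensor q ->
  \sum_J q J * \det (\matrix_(k, l) A k (J k) l) =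
  \sum_J q J * \det (\matrix_(k, l) A k (J l) l).
Proof.
move=> Sq; under eq_bigr do rewrite mulr_sumr.
under [RHS]eq_bigr do rewrite mulr_sumr.
rewrite exchange_big [RHS]exchange_big; apply: eq_bigr => s _ /=.
rewrite (reindex (fun J : {ffun 'I_n -> 'I_b} => [ffun k => J (s k)])) /=; last first.
  exists (fun J : {ffun 'I_n -> 'I_b} => [ffun k => J ((s^-1)%g k)]) => J _;
    by apply/ffunP => k; rewrite !ffunE ?permK ?permKV.
apply: eq_bigr => J _; rewrite Sq; congr (_ * (_ * _)).
by apply: eq_bigr => k _; rewrite !mxE ffunE.
Qed.

Section Complementary.
Variables (b n c : nat) (g : 'I_(b + n) -> 'I_b -> 'rV[K]_c).

(** With [J] attached to columns, the complementary minors for all [tau] come from one matrix, so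
    Laplace expansion applies for each [J]. *)
Lemma syzygy_generator_det (q : {ffun 'I_n -> 'I_b} -> K) (T : {ffun 'I_n -> 'I_c})
    (x : 'rV[K]_c) : symmetric_tensor q ->
  \sum_(sigma | incr sigma) \sum_(tau | complements sigma tau)
    (-1) ^+ #|[set p : 'I_b * 'I_n | (tau p.2 < sigma p.1)%N]|
    * minor sigma (Mat g x) * e_coord g tau q T =
  \sum_J q J * \det (row_mx (Mat g x) (\matrix_(i, l) g i (J l) 0 (T l))).
Proof.
move=> Sq.
under [RHS]eq_bigr do rewrite -laplace_expansion mulr_sumr.
rewrite exchange_big; apply: eq_bigr => sigma _ /=.
under [RHS]eq_bigr do rewrite mulr_sumr.
rewrite exchange_big; apply: eq_bigr => tau _ /=.
rewrite /e_coord (sum_det_symmetric (fun k j l => g (tau k) j 0 (T l)) Sq) mulr_sumr.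
apply: eq_bigr => J _; rewrite [RHS]mulrCA; congr (_ * (_ * \det _)).
by apply/matrixP => k l; rewrite !mxE.
Qed.

Lemma syzygy_zero_minors (q : {ffun 'I_n -> 'I_b} -> K) (x : 'rV[K]_c) :
    one_generic g -> symmetric_tensor q -> (exists J, q J != 0) ->
    (forall T : {ffun 'I_n -> 'I_c}, incr T ->
      \sum_(sigma | incr sigma) \sum_(tau | complements sigma tau)
        (-1) ^+ #|[set p : 'I_b * 'I_n | (tau p.2 < sigma p.1)%N]|
        * minor sigma (Mat g x) * e_coord g tau q T = 0) ->
  inX g x.
Proof.
(* By contraposition: a nonzero minor at [x] forces every [q J] to vanish. *)
move=> [gen1 _] Sq [J0 qJ0] syz0 sigma _; apply: contraNeq qJ0 => minor0.
apply/eqP; move: J0.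
set M := Mat g x in minor0 *.
have rkM : \rank M = b.
  apply/eqP; rewrite eqn_leq rank_leq_col /=.
  have : \matrix_(k, j) M (sigma k) j \in unitmx by rewrite unitmxE unitfE.
  move/mxrank_unit => {1}<-; apply: mxrankS; apply/row_subP => k.
  by rewrite (_ : row k _ = row (sigma k) M) ?row_sub //; apply/rowP => j; rewrite !mxE.
pose P := invmx (col_ebase M).
have uP : P \in unitmx by rewrite unitmx_inv col_ebase_unit.
have PM : P *m M = col_mx (row_ebase M) 0.
  rewrite -[X in P *m X]mulmx_ebase rkM !mulmxA mulVmx ?col_ebase_unit // mul1mx.
  by rewrite pid_mx_col mul_col_mx mul1mx mul0mx.
(* The rows of [Q] form a basis of the left kernel A' of [M]. *)
pose Q := dsubmx P.
(* The matrix of be |-> gamma(Q_k (x) be); the value 0 beyond [n] only serves to index by [nat]. *)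
pose C (k : nat) : 'M[K]_(b, c) :=
  if insub k is Some k' then \matrix_(j, t) \sum_i Q k' i * g i j 0 t else 0.
have CE (k : 'I_n) j t : C k j t = \sum_i Q k i * g i j 0 t.
  by rewrite /C valK mxE.
apply: (exterior_minors_injective (C := C)) => // [lam [k kn lamk]|T /syz0].
  (* A nontrivial combination of the [C i] is the matrix of gamma(al (x) -) with [al] nonzero, so
     1-genericity makes it row free. *)
  pose al := (\row_(k < n) lam k) *m Q.
  have al0 : al != 0.
    apply: contraNneq lamk => al0.
    have : row_mx 0 (\row_(k < n) lam k) *m P = 0.
      by rewrite -[P]vsubmxK mul_row_col mul0mx add0r.
    move/(congr1 (mulmx^~ (invmx P))); rewrite mulmxK // mul0mx.
    move/(congr1 rsubmx); rewrite row_mxKr linear0 => /rowP/(_ (Ordinal kn)).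
    by rewrite !mxE => /= ->.
  rewrite -kermx_eq0; apply/rowV0P => be /sub_kermxP beC.
  apply: (gen1 al al0).
  transitivity (be *m \sum_(i < n) lam i *: C i); last first.
    rewrite beC /gam big1 // => i _; rewrite big1 // => j _.
    by rewrite [(0 : 'rV_b) 0 j]mxE mulr0 scale0r.
  apply/rowP => t; rewrite /gam summxE [RHS]mxE.
  rewrite (eq_bigr (fun i => \sum_j al 0 i * be 0 j * g i j 0 t)); last first.
    by move=> i _; rewrite summxE; apply: eq_bigr => j _; rewrite mxE.
  rewrite exchange_big; apply: eq_bigr => j _; rewrite summxE mulr_sumr.
  transitivity (\sum_i \sum_(k < n) be 0 j * (lam k * (Q k i * g i j 0 t))).
    apply: eq_bigr => i _; rewrite mxE !mulr_suml; apply: eq_bigr => l _.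
    by rewrite [X in X * _ * _ * _]mxE [_ * be 0 j]mulrC !mulrA.
  rewrite exchange_big; apply: eq_bigr => l _ /=.
  by rewrite mxE CE -mulr_sumr -mulr_sumr.
rewrite syzygy_generator_det // -/M => S0.
rewrite (sum_det_symmetric (fun k j l => C k j (T l)) Sq).
have E0 : \det (row_ebase M) != 0.
  by rewrite -unitfE -unitmxE row_ebase_unit.
apply: (mulfI E0); rewrite mulr0 mulr_sumr.
transitivity (\det P * 0 : K); last by rewrite mulr0.
rewrite -[in RHS]S0 mulr_sumr; apply: eq_bigr => J _.
rewrite mulrCA [RHS]mulrCA; congr (_ * _).
set G := \matrix_(i, l) g i (J l) 0 (T l).
(* Multiplying by [P] makes the matrix block upper triangular, with diagonal blocks [row_ebase M]
   and [Q *m G]. *)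
rewrite -det_mulmx mul_mx_row PM -[P in P *m G]vsubmxK mul_col_mx -block_mxEh.
rewrite det_ublock; congr (_ * \det _); apply/matrixP => k l.
by rewrite !mxE CE; apply: eq_bigr => i _; rewrite !mxE.
Qed.

End Complementary.
End SyzygyScheme.

(* K = R[i] with R : realType, i.e. the complex numbers. *)
Theorem mainTheorem3 (R : realType) (a b c : nat)
  (g : 'I_a -> 'I_b -> 'rV[R[i]]_c) :
  (0 < b)%N -> (b <= a)%N -> one_generic g ->
  forall q : {ffun 'I_(a - b) -> 'I_b} -> R[i],
  symmetric_tensor q -> (exists J, q J != 0) ->
  forall x : 'rV[R[i]]_c, x != 0 -> (inSyz g q x <-> inX g x).
Proof.
move=> _ leba gen q Sq q0 x _; split; last first.
  move=> X0 T _; rewrite /syz_gen big1 // => sigma Is; rewrite big1 // => tau _.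
  by rewrite X0 // mulr0 mul0r.
move=> syz.
(* The definitions mentioning [a - b] are unfolded so that it can be generalised to [n] and [a]
   replaced by [b + n]. *)
have {syz} : forall T : {ffun 'I_(a - b) -> 'I_c}, incr T ->
  \sum_(sigma : {ffun 'I_b -> 'I_a} | incr sigma)
  \sum_(tau : {ffun 'I_(a - b) -> 'I_a}
     | [&& incr sigma, incr tau & [forall k, forall l, sigma k != tau l]])
    (-1) ^+ #|[set p : 'I_b * 'I_(a - b) | (tau p.2 < sigma p.1)%N]|
    * minor sigma (Mat g x) * e_coord g tau q T = 0 by exact: syz.
move: (a - b)%N (subnKC leba) q Sq q0 => n e q Sq q0.
case: a / e g gen {leba} => g gen.
exact: syzygy_zero_minors.
Qed.
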